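(* Let $G$ be a triangle-free graph. Then $H^{[1]}_n(G) = 0$ for all $n \ge 2$.
   Context: Graphs are simple and undirected (no loops, no multiple edges). A graph map $f\colon G\to G'$ is a map of vertex sets sending every edge to an edge or to a single vertex. $I^n$ denotes the discrete $n$-cube graph, with vertex set $\{0,1\}^n$, two vertices being adjacent iff they differ in exactly one coordinate ($I^0$ is a single vertex). A singular $n$-cube in $G$ is a graph map $\sigma\colon I^n\to G$; it is injective if it is injective on vertices. For $1\le i\le n$, $f_i^-\sigma$ and $f_i^+\sigma$ are the singular $(n-1)$-cubes obtained by fixing the $i$-th coordinate equal to $0$ and $1$ respectively. $\sigma$ is degenerate if $f_i^-\sigma=f_i^+\sigma$ for some $i$. Let $Q_n(G)$ be the free abelian group on singular $n$-cubes, with $\partial_n\sigma=\sum_{i=1}^n(-1)^i(f_i^-\sigma-f_i^+\sigma)$, let $D_*(G)\subseteq Q_*(G)$ be the subcomplex generated by degenerate cubes, and $C_*(G)=Q_*(G)/D_*(G)$. The degree of a singular $n$-cube $\sigma$ is the largest dimension $k$ of an injective face of $\sigma$ (faces of all dimensions $0\le k\le n$, including $\sigma$ itself, obtained by fixing $n-k$ of the coordinates). $C_n^k(G)\le C_n(G)$ is the subgroup generated by the nondegenerate singular $n$-cubes of degree at most $k$ (with $C_n^{-1}(G)=0$); for each $k$ this gives a subcomplex $C_*^k(G)$. Put $C_*^{[k]}(G)=C_*^k(G)/C_*^{k-1}(G)$ and $H_n^{[k]}(G)=H_n(C_*^{[k]}(G))$. A graph is triangle-free if it contains no 3-cycle as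 a subgraph. *)

(* Defs.v *)
From HB Require Import structures.
From mathcomp.multinomials Require Import freeg.
From mathcomp Require Import all_boot all_order all_algebra zify.
From mathcomp Require Import generic_quotient ring_quotient boolp.

Set Implicit Arguments.
Unset Strict Implicit.
Unset Printing Implicit Defensive.

Import Order.TTheory GRing.Theory.
Local Open Scope ring_scope.
Local Open Scope quotient_scope.

Section Subgroup.
Variables (V : zmodType) (S : zmodClosed V).

Record subgroup : Type := Subgroup { sgval : V; sgvalP : sgval \in S }.

HB.instance Definition _ := [isSub of subgroup for sgval].
HB.instance Definition _ := [Choice of subgroup by <:].
HB.instance Definition _ := [SubChoice_isSubZmodule of subgroup by <:].

Lemma sgval_is_zmod_morphism : zmod_morphism sgval.
Proof. exact: (raddfB (val : subgroup -> V)). Qed.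

HB.instance Definition _ :=
  GRing.isZmodMorphism.Build subgroup V sgval sgval_is_zmod_morphism.

End Subgroup.

Section Generated.
Variables (V : zmodType) (X : V -> Prop).

Definition generated : {pred V} :=
  fun x => `[< forall S : zmodClosed V, (forall y, X y -> y \in S) -> x \in S >].

Lemma generatedP x :
  reflect (forall S : zmodClosed V, (forall y, X y -> y \in S) -> x \in S)
          (x \in generated).
Proof. exact: asboolP. Qed.

Lemma generated_zmod_closed : zmod_closed generated.
Proof.
split; first by apply/generatedP => S _; exact: rpred0.
move=> x y /generatedP gx /generatedP gy; apply/generatedP => S XS.
by apply: rpredB; [exact: gx | exact: gy].
Qed.

HB.instance Definition _ :=
  GRing.isZmodClosed.Build V generated generated_zmod_closed.

Lemma mem_generated x : X x -> x \in generated.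
Proof. by move=> Xx; apply/generatedP => S; apply. Qed.

Lemma generated_min (S : zmodClosed V) x :
  (forall y, X y -> y \in S) -> x \in generated -> x \in S.
Proof. by move=> XS /generatedP; apply. Qed.

End Generated.

Section Preimage.
Variables (U V : zmodType) (f : {additive U -> V}) (S : zmodClosed V).

Definition preimage_group : {pred U} := fun x => f x \in S.

Lemma mem_preimage_group x : (x \in preimage_group) = (f x \in S).
Proof. by []. Qed.

Lemma preimage_group_zmod_closed : zmod_closed preimage_group.
Proof.
split=> [|x y]; rewrite !mem_preimage_group ?raddf0 ?rpred0 // => fx fy.
by rewrite raddfB rpredB.
Qed.

HB.instance Definition _ :=
  GRing.isZmodClosed.Build U preimage_group preimage_group_zmod_closed.

End Preimage.

Section Image.
Variables (U V : zmodType) (f : {additive U -> V}).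

Definition image_group : {pred V} := fun y => `[< exists x, f x = y >].

Lemma image_group_zmod_closed : zmod_closed image_group.
Proof.
split=> [|x y]; first by apply/asboolP; exists 0; rewrite raddf0.
move=> /asboolP[a <-] /asboolP[b <-]; apply/asboolP.
by exists (a - b); rewrite raddfB.
Qed.

HB.instance Definition _ := GRing.isZmodClosed.Build V image_group image_group_zmod_closed.

End Image.

Section TrivialSubgroups.
Variable V : zmodType.

Definition whole : {pred V} := predT.
Lemma whole_zmod_closed : zmod_closed whole. Proof. by split. Qed.
HB.instance Definition _ := GRing.isZmodClosed.Build V whole whole_zmod_closed.

Definition zero_group : {pred V} := pred1 0.
Lemma zero_group_zmod_closed : zmod_closed zero_group.
Proof.
split=> [|x y]; first exact: eqxx.
by move=> /eqP-> /eqP->; apply/eqP; rewrite subr0.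
Qed.
HB.instance Definition _ :=
  GRing.isZmodClosed.Build V zero_group zero_group_zmod_closed.

End TrivialSubgroups.

Arguments whole : clear implicits.
Arguments zero_group : clear implicits.

Section Induced.
Variables (U V : zmodType) (f : {additive U -> V}).
Variables (S : zmodClosed U) (T : zmodClosed V).
Hypothesis fST : forall x, x \in S -> f x \in T.

Definition restrict (x : subgroup S) : subgroup T := Subgroup (fST (sgvalP x)).

Lemma restrict_is_zmod_morphism : zmod_morphism restrict.
Proof. by move=> x y; apply: val_inj => /=; rewrite !raddfB. Qed.

HB.instance Definition _ :=
  GRing.isZmodMorphism.Build _ _ restrict restrict_is_zmod_morphism.

Definition quotient_fun (x : Quotient.quot S) : Quotient.quot T :=
  \pi_(Quotient.quot T) (f (repr x)).

Lemma quotient_fun_pi x :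
  quotient_fun (\pi_(Quotient.quot S) x) = \pi_(Quotient.quot T) (f x).
Proof.
apply/eqP; rewrite /quotient_fun -Quotient.idealrBE -raddfB; apply: fST.
by rewrite Quotient.idealrBE reprK.
Qed.

Lemma quotient_fun_is_zmod_morphism : zmod_morphism quotient_fun.
Proof.
move=> x y; rewrite -[x]reprK -[y]reprK -raddfB !quotient_fun_pi.
by rewrite !raddfB.
Qed.

Definition quotient_map : {additive Quotient.quot S -> Quotient.quot T} :=
  HB.pack quotient_fun
    (GRing.isZmodMorphism.Build _ _ quotient_fun quotient_fun_is_zmod_morphism).

Lemma quotient_map_pi x :
  quotient_map (\pi_(Quotient.quot S) x) = \pi_(Quotient.quot T) (f x).
Proof. exact: quotient_fun_pi. Qed.

End Induced.

Arguments restrict {U V} f {S T} fST x.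
Arguments quotient_map {U V} f {S T} fST.

Record complex : Type := Complex {
  chains :> nat -> zmodType;
  diff : forall n, {additive chains n.+1 -> chains n};
  diffK : forall n (x : chains n.+2), diff n (diff n.+1 x) = 0
}.

Section Homology.
Variable C : complex.

Definition cycles (n : nat) : zmodClosed (C n) :=
  match n return zmodClosed (C n) with
  | 0 => whole (C 0)
  | m.+1 => preimage_group (diff C m) (zero_group (C m))
  end.

Definition boundaries (n : nat) : zmodClosed (C n) := image_group (diff C n).

Definition homology (n : nat) : zmodType :=
  Quotient.quot (preimage_group (@sgval _ (cycles n)) (boundaries n)).

End Homology.

Record subcomplex (C : complex) : Type := Subcomplex {
  subchains :> forall n, zmodClosed (C n);
  diff_subchains :
    forall n x, x \in subchains n.+1 -> diff C n x \in subchains n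
}.

Section SubQuotient.
Variables (C : complex) (S : subcomplex C).

Definition sub_chains n : zmodType := subgroup (S n).
Definition sub_diff n : {additive sub_chains n.+1 -> sub_chains n} :=
  restrict (diff C n) (@diff_subchains C S n).

Lemma sub_diffK n (x : sub_chains n.+2) : sub_diff n (sub_diff n.+1 x) = 0.
Proof. by apply: val_inj; rewrite /= diffK. Qed.

Definition sub_complex : complex := Complex sub_diffK.

Definition quotient_chains n : zmodType := Quotient.quot (S n).
Definition quotient_diff n :
    {additive quotient_chains n.+1 -> quotient_chains n} :=
  quotient_map (diff C n) (@diff_subchains C S n).

Lemma quotient_diffK n (x : quotient_chains n.+2) :
  quotient_diff n (quotient_diff n.+1 x) = 0.
Proof.
by rewrite -[x]reprK /quotient_diff !quotient_map_pi diffK raddf0.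
Qed.

Definition quotient_complex : complex := Complex quotient_diffK.

End SubQuotient.

(* [T] viewed inside [S], i.e. the subcomplex [S `&` T] of [sub_complex S]. *)
Section Relative.
Variables (C : complex) (S T : subcomplex C).

Definition within_chains n : zmodClosed (sub_complex S n) :=
  preimage_group (@sgval _ (S n)) (T n).

Lemma diff_within n x :
  x \in within_chains n.+1 -> diff (sub_complex S) n x \in within_chains n.
Proof. exact: diff_subchains. Qed.

Definition within : subcomplex (sub_complex S) := Subcomplex diff_within.

End Relative.

(* Taking a choiceType of vertices and a boolean adjacency loses no generality *)
(* since [boolp] equips every type with a choice structure and reflects every  *)
(* proposition into [bool].                                                    *)
Record graph : Type := Graph {
  vertex :> choiceType;
  edge : rel vertex;
  edge_sym : symmetric edge;
  edge_irrefl : irreflexive edge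
}.

Definition graph_map (G G' : graph) (f : G -> G') : Prop :=
  forall x y, edge x y -> edge (f x) (f y) \/ f x = f y.

Definition triangle_free (G : graph) : Prop :=
  ~ exists x y z : G, [/\ edge x y, edge y z & edge z x].

Section CubeGraph.
Variable n : nat.

Definition cube_edge (x y : {ffun 'I_n -> bool}) : bool :=
  #|[pred i | x i != y i]| == 1.

Lemma cube_edge_sym : symmetric cube_edge.
Proof.
by move=> x y; congr (_ == _); apply: eq_card => i; rewrite !inE eq_sym.
Qed.

Lemma cube_edge_irrefl : irreflexive cube_edge.
Proof.
by move=> x; rewrite /cube_edge eq_card0 // => i; rewrite !inE eqxx.
Qed.

Definition cube_graph : graph := Graph cube_edge_sym cube_edge_irrefl.

End CubeGraph.

Section Coordinates.
Variable n : nat.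

Definition insert (i : 'I_n.+1) (b : bool) (x : {ffun 'I_n -> bool}) :
    {ffun 'I_n.+1 -> bool} :=
  [ffun j => if unlift i j is Some j' then x j' else b].

Lemma insert_at i b x : insert i b x i = b.
Proof. by rewrite ffunE unlift_none. Qed.

Lemma insert_lift i b x j : insert i b x (lift i j) = x j.
Proof. by rewrite ffunE liftK. Qed.

Lemma insert_edge i b x y :
  cube_edge (insert i b x) (insert i b y) = cube_edge x y.
Proof.
congr (_ == _); rewrite -!sum1_card big_mkcond (bigD1_ord i) //=.
rewrite inE !insert_at eqxx add0n [RHS]big_mkcond; apply: eq_bigr => j _.
by rewrite !inE !insert_lift.
Qed.

End Coordinates.

Lemma insertC n (i k : 'I_n.+2) (j j' : 'I_n.+1) a b x :
  k = lift i j -> i = lift k j' ->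
  insert i a (insert j b x) = insert k b (insert j' a x).
Proof.
move=> ek ei; apply/ffunP => m.
have [->|mi] := eqVneq m i; first by rewrite insert_at ei insert_lift insert_at.
have [->|mk] := eqVneq m k; first by rewrite insert_at ek insert_lift insert_at.
have [m1 em1] : exists m1, m = lift i m1.
  by case: (unliftP i m) mi => [m1 ->|->]; [exists m1 | rewrite eqxx].
have [m2 em2] : exists m2, m = lift k m2.
  by case: (unliftP k m) mk => [m2 ->|->]; [exists m2 | rewrite eqxx].
rewrite {1}em1 em2 !insert_lift.
case: (unliftP j m1) em1 => [p ->|->] em1; last by rewrite em1 ek eqxx in mk.
case: (unliftP j' m2) em2 => [q ->|->] em2; last by rewrite em2 -ei eqxx in mi.
rewrite !insert_lift; congr (x _); apply: val_inj.
have /(congr1 val) := etrans (esym em1) em2.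
move/(congr1 val): ek; move/(congr1 val): ei; rewrite /= /bump.
by lia.
Qed.

Section Cubes.
Variable G : graph.

Record cube (n : nat) : Type := Cube {
  cube_fun :> {ffun cube_graph n -> G};
  cube_graph_map : `[< @graph_map (cube_graph n) G cube_fun >]
}.

HB.instance Definition _ n := [isSub of cube n for @cube_fun n].
HB.instance Definition _ n := [Choice of cube n by <:].

Lemma cubeP n (s : cube n) : @graph_map (cube_graph n) G s.
Proof. exact/asboolP/cube_graph_map. Qed.

Lemma face_graph_map n (s : cube n.+1) i b :
  `[< @graph_map (cube_graph n) G [ffun x => s (insert i b x)] >].
Proof.
by apply/asboolP => x y xy; rewrite !ffunE; apply: cubeP; rewrite /= insert_edge.
Qed.

(* The coordinates are numbered from 0, so [face i false s] and               *)
(* [face i true s] are the faces f_(i+1)^- s and f_(i+1)^+ s.                 *)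
Definition face n (i : 'I_n.+1) (b : bool) (s : cube n.+1) : cube n :=
  Cube (face_graph_map s i b).

Lemma faceE n i b (s : cube n.+1) x : face i b s x = s (insert i b x).
Proof. by rewrite ffunE. Qed.

Definition degenerate n : pred (cube n) :=
  match n with
  | 0 => fun=> false
  | _.+1 => fun s => [exists i, face i false s == face i true s]
  end.

Lemma faceC n (s : cube n.+2) (i k : 'I_n.+2) (j j' : 'I_n.+1) a b :
  k = lift i j -> i = lift k j' ->
  face j b (face i a s) = face j' a (face k b s).
Proof.
move=> ek ei; apply/val_inj/ffunP => x; rewrite /= !ffunE.
by congr (s _); exact: insertC.
Qed.

(* A face of the n-cube is given by a partial assignment of its coordinates:  *)
(* [p i = Some b] fixes the i-th coordinate equal to [b], and the coordinates *)
(* with [p i = None] are free.                                                *)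
Section Degree.
Variables (n : nat) (s : cube n).

Definition face_dim (p : {ffun 'I_n -> option bool}) : nat :=
  #|[pred i | p i == None]|.

Definition face_vertices (p : {ffun 'I_n -> option bool}) :
    {pred {ffun 'I_n -> bool}} :=
  fun x => [forall i, (p i == None) || (p i == Some (x i))].

Lemma in_face_vertices p x :
  (x \in face_vertices p) = [forall i, (p i == None) || (p i == Some (x i))].
Proof. by []. Qed.

Definition injective_face (p : {ffun 'I_n -> option bool}) : bool :=
  [forall x in face_vertices p, forall y in face_vertices p,
     (s x == s y) ==> (x == y)].

Definition degree : nat := \max_(p | injective_face p) face_dim p.

End Degree.

Lemma degree_face n (s : cube n.+1) i b : (degree (face i b s) <= degree s)%N.
Proof.
apply/bigmax_leqP => p /'forall_implyP injp.
pose q : {ffun 'I_n.+1 -> option bool} :=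
  [ffun j => if unlift i j is Some j' then p j' else Some b].
have qE x : x \in face_vertices q ->
    exists2 y, y \in face_vertices p & x = insert i b y.
  rewrite in_face_vertices => /forallP qx; exists [ffun j => x (lift i j)].
    rewrite in_face_vertices; apply/forallP => j; have := qx (lift i j).
    by rewrite !ffunE liftK.
  apply/ffunP => j; rewrite ffunE; case: unliftP => [j' ->|->].
    by rewrite ffunE.
  by have := qx i; rewrite ffunE unlift_none => /eqP[].
have injq : injective_face s q.
  apply/'forall_implyP => x /qE[x' px ->].
  apply/'forall_implyP => y /qE[y' py ->].
  apply/implyP => sxy; have /'forall_implyP/(_ y' py) := injp x' px.
  by rewrite !faceE sxy => /eqP->.
apply: leq_trans (leq_bigmax_cond _ injq).
rewrite /face_dim -!sum1_card [X in (_ <= X)%N]big_mkcond (bigD1_ord i) //=.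
rewrite inE ffunE unlift_none add0n.
rewrite [X in (X <= _)%N]big_mkcond; apply/eq_leq/eq_bigr => j _.
by rewrite !inE ffunE liftK.
Qed.

Definition cubical_chains (n : nat) : zmodType := {freeg (cube n) / int}.

Definition cube_boundary n (s : cube n.+1) : {freeg (cube n) / int} :=
  \sum_(i < n.+1) (-1) ^+ i.+1 *: (<< face i false s >> - << face i true s >>).

Definition boundary n : cubical_chains n.+1 -> cubical_chains n :=
  fglift (@cube_boundary n).

HB.instance Definition _ n :=
  GRing.isZmodMorphism.Build (cubical_chains n.+1) (cubical_chains n)
    (@boundary n) (@lift_is_additive _ _ _ (@cube_boundary n)).

Lemma boundaryU n (s : cube n.+1) : boundary << s >> = cube_boundary s.
Proof. by rewrite /boundary liftU scale1r. Qed.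

Lemma eq_chain_map n (V : zmodType) (f g : {additive cubical_chains n -> V}) :
  (forall s : cube n, f << s >> = g << s >>) -> f =1 g.
Proof.
move=> fg x; rewrite -(freeg_sumE (x : {freeg (cube n) / int})).
rewrite !raddf_sum; apply: eq_bigr => s _.
rewrite -[coeff s x]intz -freegU_mulz.
by rewrite [LHS](raddfMz f) [RHS](raddfMz g) fg.
Qed.

Lemma boundaryK n (x : cubical_chains n.+2) : boundary (boundary x) = 0.
Proof.
move: x.
apply: (eq_chain_map (f := @boundary n \o @boundary n.+1) (g := \0)) => s /=.
pose dd (i : 'I_n.+2) (j : 'I_n.+1) : cubical_chains n :=
  (<< face j false (face i false s) >> - << face j true (face i false s) >>)
  - (<< face j false (face i true s) >> - << face j true (face i true s) >>).
pose F (p : 'I_n.+2 * 'I_n.+1) : cubical_chains n :=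
  (-1) ^+ (p.1 + p.2)%N *: dd p.1 p.2.
have -> : boundary << s >> = \sum_(i < n.+2)
    (-1) ^+ i.+1 *: (<< face i false s >> - << face i true s >>)
    :> cubical_chains n.+1.
  exact: boundaryU.
rewrite raddf_sum.
transitivity (\sum_p F p).
  rewrite -(pair_bigA _ (fun i j => F (i, j))) /=; apply: eq_bigr => i _.
  rewrite raddfZsign raddfB /= !boundaryU /cube_boundary -sumrB scaler_sumr.
  apply: eq_bigr => j _; rewrite -scalerBr scalerA -exprD addSn addnS !exprS.
  by rewrite !mulN1r opprK.
rewrite (bigID (fun p : 'I_n.+2 * 'I_n.+1 => (p.1 <= p.2)%N)) /=.
pose h (p : 'I_n.+2 * 'I_n.+1) : 'I_n.+2 * 'I_n.+1 :=
  (lift p.1 p.2, inord p.1).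
pose h' (p : 'I_n.+2 * 'I_n.+1) : 'I_n.+2 * 'I_n.+1 :=
  (widen_ord (leqnSn _) p.2, inord p.1.-1).
rewrite [X in _ + X](reindex_onto h h') => [|[k j'] /=]; last first.
  rewrite -ltnNge => ltjk; congr (_, _); apply: val_inj => /=; last first.
    by rewrite inordK //= ltn_ord.
  by rewrite /bump inordK; have := ltn_ord k; lia.
rewrite [X in _ + X](eq_bigl (fun p : 'I_n.+2 * 'I_n.+1 => (p.1 <= p.2)%N));
  last first.
  case=> i j /=; apply/andP/idP => [[]|leij].
    move=> gtij /eqP[/(congr1 val) /= ei _].
    move: gtij; rewrite -ltnNge ei /bump; by case: leqP => //= ltji; lia.
  split; first by rewrite -ltnNge inordK; have := ltn_ord j; rewrite /bump; lia.
  apply/eqP; congr (_, _); apply: val_inj => /=.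
    by rewrite inordK; have := ltn_ord j; lia.
  by rewrite /bump leij inordK; have := ltn_ord j; lia.
rewrite -big_split big1 // => -[i j] /= leij.
have ei : i = lift (lift i j) (inord i : 'I_n.+1).
  apply: val_inj; rewrite /= /bump leij inordK; have := ltn_ord j; lia.
have eS : (lift i j + (inord i : 'I_n.+1) = (i + j).+1)%N.
  by rewrite /= /bump leij inordK; have := ltn_ord j; lia.
rewrite /F [in X in _ + X]eS exprS mulN1r scaleNr /dd /=.
rewrite -!(faceC s _ _ erefl ei); apply/eqP; rewrite subr_eq0; apply/eqP.
by congr (_ *: _); rewrite !opprD !opprK addrACA.
Qed.

Definition cubical_complex : complex := Complex boundaryK.

Definition D_generator n (x : cubical_chains n) : Prop :=
  exists2 s : cube n, degenerate s & x = << s >>.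

Lemma degenerate_face n (s : cube n.+1) (i i0 : 'I_n.+1) b :
  i != i0 -> face i0 false s = face i0 true s -> degenerate (face i b s).
Proof.
case: n => [|n] in s i i0 *; first by rewrite !ord1 eqxx.
move=> ii0 ds.
case: (unliftP i i0) (ii0) => [j ei0 _|->]; last by rewrite eqxx.
case: (unliftP i0 i) (ii0) => [j' ei _|->]; last by rewrite eqxx.
by apply/existsP; exists j; rewrite !(faceC s _ _ ei0 ei) ds.
Qed.

Lemma boundary_D n x :
  x \in generated (@D_generator n.+1) ->
  boundary x \in generated (@D_generator n).
Proof.
apply: (generated_min (S := preimage_group (@boundary n) _)) => {x} _ [s ds ->].
have /existsP[i0 /eqP di0] := ds.
rewrite mem_preimage_group /= boundaryU; apply: rpred_sum => i _.
rewrite rpredZsign; have [->|ii0] := eqVneq i i0.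
  by rewrite di0 subrr rpred0.
apply: rpredB; apply: mem_generated.
  by exists (face i false s) => //; exact: degenerate_face di0.
by exists (face i true s) => //; exact: degenerate_face di0.
Qed.

Definition degenerate_subcomplex : subcomplex cubical_complex :=
  @Subcomplex cubical_complex (fun n => generated (@D_generator n)) boundary_D.

Definition normalized_complex : complex :=
  quotient_complex degenerate_subcomplex.

Definition cube_class n (s : cube n) : normalized_complex n :=
  \pi_(Quotient.quot (degenerate_subcomplex n)) << s >>.

Definition C_generator (k : int) n (x : normalized_complex n) : Prop :=
  exists s : cube n,
    [/\ ~~ degenerate s, (degree s)%:Z <= k & x = cube_class s].

Lemma cube_class_degenerate n (s : cube n) : degenerate s -> cube_class s = 0.
Proof.
move=> ds; rewrite /cube_class.
rewrite -[RHS](raddf0 (\pi_(Quotient.quot (degenerate_subcomplex n)))).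
apply/eqP; rewrite -Quotient.idealrBE subr0; apply: mem_generated.
by exists s.
Qed.

Lemma diff_cube_class n (s : cube n.+1) :
  diff normalized_complex n (cube_class s) =
  \pi_(Quotient.quot (degenerate_subcomplex n)) (cube_boundary s).
Proof. by rewrite [LHS]quotient_map_pi /= boundaryU. Qed.

Lemma diff_C_le k n x :
  x \in generated (@C_generator k n.+1) ->
  diff normalized_complex n x \in generated (@C_generator k n).
Proof.
apply: (generated_min (S := preimage_group (diff normalized_complex n) _)).
move=> {x} _ [s [ds dk ->]].
rewrite mem_preimage_group diff_cube_class.
have mem_face i b : cube_class (face i b s) \in generated (@C_generator k n).
  have [/cube_class_degenerate->|dfs] := boolP (degenerate (face i b s)).
    exact: rpred0.
  apply: mem_generated; exists (face i b s); split=> //.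
  by apply: le_trans dk; rewrite lez_nat degree_face.
change (cube_boundary s \in
  preimage_group (\pi_(Quotient.quot (degenerate_subcomplex n)))
    (generated (@C_generator k n))).
apply: rpred_sum => i _; rewrite rpredZsign.
by apply: rpredB; rewrite mem_preimage_group; exact: mem_face.
Qed.

Definition C_le (k : int) : subcomplex normalized_complex :=
  @Subcomplex normalized_complex (fun n => generated (@C_generator k n))
    (@diff_C_le k).

Definition C_graded (k : int) : complex :=
  quotient_complex (within (C_le k) (C_le (k - 1))).

Definition H_graded (k : int) (n : nat) : zmodType := homology (C_graded k) n.

End Cubes.

(* Main.v *)
From HB Require Import structures.
Require Import Defs.
From mathcomp.multinomials Require Import freeg.
From mathcomp Require Import all_boot all_order all_algebra zify.
From mathcomp Require Import generic_quotient ring_quotient boolp.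

(* In a triangle-free graph a square that is not injective either collapses  *)
(* onto an edge or has two equal opposite corners, so a cube of degree at    *)
(* most 1 lifts to the universal cover of the graph, which is a tree. Its    *)
(* lift spans a finite subtree, unique up to deck transformations. Moving    *)
(* all leaves of this subtree that carry one canonically chosen label to     *)
(* their neighbours gives a homotopy from the cube to a cube whose subtree   *)
(* has fewer vertices. The homotopy commutes with those faces that reach the *)
(* whole subtree; any other face misses a leaf, hence spans fewer vertices,  *)
(* and so does the homotopy on it, unless it is degenerate. Induction on the *)
(* number of vertices then shows that every cycle of dimension at least 2    *)
(* bounds modulo degenerate cubes; constant cubes play no role, since they   *)
(* are degenerate in positive dimension.                                     *)

Set Implicit Arguments.
Unset Strict Implicit.
Unset Printing Implicit Defensive.

Import GRing.Theory.
Local Open Scope ring_scope.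
Local Open Scope quotient_scope.

(** Degree at most 1 means that no face of dimension 2 or more is injective. Triangle-freeness then
    makes every square flat, and a cube with flat squares lifts to the universal cover, a tree
    ([flat_good], [degree1_good]; conversely [good_degree1]). Cubes of degree 0 vanish in positive
    dimension, so it remains to show that chains of liftable cubes are exact modulo degenerate ones.

    Each such cube [s] is contracted step by step inside its own finite subtree: [prism] is a
    homotopy from [s] to [s] composed with [retract]. Let P be its linear extension and d the
    boundary. The operator id + dP + Pd lowers the number [nclasses] of tree vertices
    ([homotopy_good]): the far end of the prism loses a vertex or is degenerate, the sides over
    faces that reach the whole tree cancel against the prisms over those faces ([face_prism_onto]),
    and the remaining terms have fewer vertices or are degenerate ([mem_F_missing_prism],
    [mem_F_prism_missing]). Iterating this in [cycle_bounds] leaves only degenerate chains. *)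

(** * Coordinate flips as the edges of the cube *)

Section Flip.
Variable n : nat.
Implicit Types (x y : {ffun 'I_n -> bool}) (i j k : 'I_n).

Definition flip i x : {ffun 'I_n -> bool} := [ffun j => x j (+) (j == i)].

Lemma flipK i : involutive (flip i).
Proof. by move=> x; apply/ffunP => j; rewrite !ffunE -addbA addbb addbF. Qed.

Lemma flipC i j x : flip i (flip j x) = flip j (flip i x).
Proof. by apply/ffunP => k; rewrite !ffunE addbAC. Qed.

Lemma cube_edgeP x y : reflect (exists i, y = flip i x) (cube_edge x y).
Proof.
apply: (iffP idP) => [/card1P[i xy]|[i ->]].
  exists i; apply/ffunP => j; rewrite ffunE; have := xy j; rewrite !inE => <-.
  by case: (x j); case: (y j).
apply/card1P; exists i => j; rewrite !inE ffunE.
by case: (x j); case: (j == i).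
Qed.

Lemma edge_flip i x : cube_edge x (flip i x).
Proof. by apply/cube_edgeP; exists i. Qed.

(** Connectedness of the cube, by induction on the number of coordinates in which [x] differs from
    [x0]. *)
Lemma flip_ind x0 (P : {ffun 'I_n -> bool} -> Prop) :
  P x0 -> (forall x i, P x -> P (flip i x)) -> forall x, P x.
Proof.
move=> P0 PS x; have [m] := ubnP #|[pred i | x i != x0 i]|.
elim: m x => // m IH x; rewrite ltnS => ltm; have [->//|/eqP] := eqVneq x x0.
move/eqP => xx0; have [i xi] : exists i, x i != x0 i.
  apply/existsP; apply: contraNT xx0 => /existsPn xx0; apply/eqP/ffunP => i.
  by apply/eqP; have := xx0 i; rewrite negbK.
rewrite -(flipK i x); apply/PS/IH; apply: leq_trans ltm.
rewrite [X in (_ < X)%N](cardD1 i) inE xi add1n ltnS; apply: subset_leq_card.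
apply/subsetP => j; rewrite !inE ffunE.
have [->|_] := eqVneq j i; last by rewrite addbF.
by case: (x i) xi; case: (x0 i).
Qed.

End Flip.

Section InsertFlip.
Variable n : nat.
Implicit Types (x : {ffun 'I_n -> bool}) (i : 'I_n.+1) (j : 'I_n).

Lemma insert_flip i b j x :
  insert i b (flip j x) = flip (lift i j) (insert i b x).
Proof.
apply/ffunP => k; rewrite !ffunE; case: unliftP => [k' ->|->].
  by rewrite ffunE (inj_eq lift_inj).
by rewrite (negbTE (neq_lift _ _)) addbF.
Qed.

Lemma flip_insert i b x : flip i (insert i b x) = insert i (~~ b) x.
Proof.
apply/ffunP => k; rewrite !ffunE; case: unliftP => [k' ->|->].
  by rewrite eq_sym (negbTE (neq_lift _ _)) addbF.
by rewrite eqxx addbT.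
Qed.

Lemma insert_lift_ord0 m (k : 'I_m.+1) b (z : {ffun 'I_m.+1 -> bool}) :
  insert (lift ord0 k) b z ord0 = z ord0.
Proof.
rewrite -[RHS](insert_lift (lift ord0 k) b).
by congr (insert _ _ _ _); apply: val_inj.
Qed.

End InsertFlip.

(** * Walks in the universal cover *)

Section Words.
Variable G : graph.
Implicit Types (a b c d : G) (w u : seq G).

(* A vertex of the universal cover of G is a non-backtracking walk, recorded *)
(* as the list of its vertices with the endpoint first; [step b w] is the    *)
(* end of the lift at [w] of an edge (or constant move) towards [b].         *)
Definition step b w : seq G :=
  if w is a :: w' then
    if a == b then w else if ohead w' == Some b then w' else b :: w
  else [:: b].

Fixpoint reduced w : bool :=
  if w is a :: w' then
    if w' is b :: w'' then
      [&& edge a b, ohead w'' != Some a & reduced w']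
    else true
  else true.

Lemma ohead_step b w : ohead (step b w) = Some b.
Proof.
case: w => //= a w; case: eqP => [->//|_].
by case: eqP.
Qed.

Lemma reduced_behead a w : reduced (a :: w) -> reduced w.
Proof. by case: w => //= b w /and3P[]. Qed.

Lemma reduced_step a b w :
  reduced w -> ohead w = Some a -> edge a b \/ a = b -> reduced (step b w).
Proof.
case: w => // c w rw [ca] ab /=; rewrite {c}ca in rw *.
have [//|ne] := eqVneq a b.
case: ab => [ab|/eqP]; last by rewrite (negbTE ne).
case: ifP => [_|/negbT nb]; first exact: reduced_behead rw.
by apply/and3P; split=> //; rewrite edge_sym.
Qed.

Lemma step_id b w : ohead w = Some b -> step b w = w.
Proof. by case: w => //= a w [->]; rewrite eqxx. Qed.

(** If the first step deletes the head of [w], non-backtracking ensures that the second one pushes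
    it back instead of deleting once more. *)
Lemma step_back a b w :
  reduced w -> ohead w = Some a -> step a (step b w) = w.
Proof.
case: w => // c w rw [ca] /=; rewrite {c}ca in rw *; have [->|ne] := eqVneq a b.
  by rewrite /= eqxx.
have [|_] := eqVneq; last by rewrite /= eq_sym (negbTE ne) eqxx.
case: w rw => // d w /and3P[_ nb _] [->] /=.
by rewrite eq_sym (negbTE ne) (negbTE nb).
Qed.

Lemma step_cases b w :
  w != [::] -> [\/ step b w = w, w = head b w :: step b w | step b w = b :: w].
Proof.
case: w => // a w _ /=; case: eqP => _; first by constructor 1.
by case: eqP => _; [constructor 2|constructor 3].
Qed.

(* The squares that do not wrap around an injective 4-cycle. *)
Definition flat_square a b c d : Prop :=
  [\/ a = c, b = d, a = b /\ c = d | a = d /\ b = c].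

Lemma step_flat a b c d w : reduced w -> ohead w = Some a ->
  flat_square a b c d -> step c (step b w) = step c (step d w).
Proof.
move=> rw aw [<-|->//|[<- <-]|[<- <-]].
- by rewrite !step_back.
- by rewrite (step_id aw) (step_id (ohead_step _ _)).
- by rewrite (step_id aw) (step_id (ohead_step _ _)).
Qed.

(** A tree has no injective 4-cycle. With distinct labels, at most one of the two first steps
    deletes [a]; two pushing routes end in walks with different second vertices, and a pushing and a
    deleting route end in walks of different lengths. *)
Lemma step_square a b c d w : reduced w -> ohead w = Some a ->
  step c (step b w) = step c (step d w) -> ~~ uniq [:: a; b; c; d].
Proof.
move=> rw aw; apply: contra_eqN => /=.
rewrite !inE !negb_or !andbT => /and3P[/and3P[ab ac ad] /andP[bc bd] cd].
case: w aw rw => // e w [->] rw; rewrite /= (negbTE ab) (negbTE ad).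
have top x : x != c -> step c (x :: a :: w) = [:: c, x, a & w].
  move=> xc /=; rewrite (negbTE xc); case: eqP => // -[/eqP].
  by rewrite (negbTE ac).
have low x : x != c -> ohead w = Some x -> (size (step c w) <= (size w).+1)%N.
  move=> xc; case: (w) => // y v [->] /=; rewrite (negbTE xc).
  by case: ifP => _ //=; rewrite 2?ltnW.
have dc : d != c by rewrite eq_sym.
have [wb|_] := eqVneq (ohead w) (Some b);
  have [wd|_] := eqVneq (ohead w) (Some d).
- by move: wd; rewrite wb => -[/eqP]; rewrite (negbTE bd).
- rewrite (top d) //; apply: contraTneq (low _ bc wb) => ->.
  by rewrite -ltnNge /=.
- rewrite (top b) //; apply: contraTneq (low d dc wd) => <-.
  by rewrite -ltnNge /=.
by rewrite !top //; apply: contra bd => /eqP[->].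
Qed.

(* Changing base points: [foldr step w u] is the end of the walk [u] lifted  *)
(* so as to start at [w].                                                    *)
Lemma foldr_step a u w : reduced (rcons u a) -> reduced w -> ohead w = Some a ->
  reduced (foldr step w (rcons u a)) /\
  ohead (foldr step w (rcons u a)) = ohead (rcons u a).
Proof.
elim: u => [|b u IH] ru rw aw /=.
  by rewrite step_id.
rewrite ohead_step; have [ru' hu'] := IH (reduced_behead ru) rw aw.
split=> //; case: u ru ru' hu' {IH} => [|c u] /= /andP[bc _] ru' hu'.
  by apply: reduced_step hu' _ => //; left; rewrite edge_sym.
by apply: reduced_step hu' _ => //; left; rewrite edge_sym.
Qed.

(** A step that cancels the head of the walk is matched by [step_back] in the image. *)
Lemma foldr_stepE a b u w :
  reduced (rcons u a) -> reduced w -> ohead w = Some a ->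
  foldr step w (step b (rcons u a)) = step b (foldr step w (rcons u a)).
Proof.
move=> ru rw aw; have [ru' hu'] := foldr_step ru rw aw.
have foldrE c v : foldr step w (c :: v) = step c (foldr step w v) by [].
case: u ru ru' hu' => [|c u] ru ru' hu'.
  rewrite /= [step a w]step_id //; have [<-|_] := eqVneq a b.
    by rewrite /= !step_id.
  by rewrite /= [step a w]step_id.
rewrite rcons_cons [step b (c :: _)]/= in ru *.
have [ruw huw] := foldr_step (reduced_behead ru) rw aw.
have [eqcb|_] := eqVneq c b.
  by rewrite [RHS]step_id // foldrE ohead_step eqcb.
by case: eqP => // hb; rewrite foldrE step_back ?huw.
Qed.

End Words.

(** * Lifts of cubes *)

Section Lifts.
Variable G : graph.

Section Cube.
Variables (n : nat) (s : cube G n).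
Implicit Types (x y z : {ffun 'I_n -> bool}) (L : {ffun 'I_n -> bool} -> seq G).

(** A lift to the universal cover based at [s x0]. The rule is imposed along every edge of the cube,
    not just along a spanning tree; this is the obstruction. *)
Definition rooted_lift x0 L : Prop :=
  L x0 = [:: s x0] /\ forall x i, L (flip i x) = step (s (flip i x)) (L x).

Definition good : Prop := forall x0, exists L, rooted_lift x0 L.

(** The value [[::]] is a default for cubes without a lift; actual lifts are never empty. *)
Definition lifting x0 : {ffun 'I_n -> bool} -> seq G :=
  if pselect (exists L, rooted_lift x0 L) is left h then projT1 (cid h)
  else fun=> [::].

Lemma liftingP x0 : good -> rooted_lift x0 (lifting x0).
Proof.
rewrite /lifting => gs; case: pselect => [h|]; first by case: cid.
by have := gs x0.
Qed.

Lemma rooted_lift_unique x0 L L' :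
  rooted_lift x0 L -> rooted_lift x0 L' -> L =1 L'.
Proof.
move=> [L0 LS] [L'0 L'S]; apply: (flip_ind (x0 := x0)); first by rewrite L0.
by move=> x i LL'; rewrite LS L'S LL'.
Qed.

Lemma edge_label x i : edge (s x) (s (flip i x)) \/ s x = s (flip i x).
Proof. exact/cubeP/edge_flip. Qed.

Lemma rooted_liftP x0 L : rooted_lift x0 L -> forall x,
  [/\ reduced (L x), ohead (L x) = Some (s x) & exists u, L x = rcons u (s x0)].
Proof.
move=> [L0 LS]; apply: (flip_ind (x0 := x0)).
  by rewrite L0; split=> //; exists [::].
move=> x i [rL hL [u Lu]]; split; rewrite LS ?ohead_step //.
  by apply: reduced_step hL (edge_label x i).
rewrite Lu; case: u {Lu} => [|c u] /=; case: eqP => _.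
- by exists [::].
- by exists [:: s (flip i x)].
- by exists (c :: u).
case: eqP => _; first by exists u.
by exists [:: s (flip i x), c & u].
Qed.

Hypothesis gs : good.

Lemma lifting_reduced x0 x : reduced (lifting x0 x).
Proof. by case: (rooted_liftP (liftingP x0 gs) x). Qed.

Lemma ohead_lifting x0 x : ohead (lifting x0 x) = Some (s x).
Proof. by case: (rooted_liftP (liftingP x0 gs) x). Qed.

Lemma lifting_flip x0 i x :
  lifting x0 (flip i x) = step (s (flip i x)) (lifting x0 x).
Proof. by case: (liftingP x0 gs). Qed.

Lemma foldr_lifting x0 x b w : reduced w -> ohead w = Some (s x0) ->
  foldr (@step G) w (step b (lifting x0 x)) =
  step b (foldr (@step G) w (lifting x0 x)).
Proof.
move=> rw hw; have [rL _ [u Lu]] := rooted_liftP (liftingP x0 gs) x.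
by move: rL; rewrite Lu => rL; apply: foldr_stepE.
Qed.

(** Both sides obey the same step rule and agree at [x0]. *)
Lemma lifting_change x0 x1 x :
  lifting x1 x = foldr (@step G) (lifting x1 x0) (lifting x0 x).
Proof.
move: x; apply: (flip_ind (x0 := x0)) => [|x i IH].
  by case: (liftingP x0 gs) => -> _ /=; rewrite step_id // ohead_lifting.
by rewrite !lifting_flip foldr_lifting ?lifting_reduced ?ohead_lifting // IH.
Qed.

End Cube.

Definition origin n : {ffun 'I_n -> bool} := [ffun=> false].

(* [same] and [linked] relate vertices whose lifts are equal, resp. equal or *)
(* adjacent, in the universal cover; they do not depend on the base point.   *)
Definition same n (s : cube G n) x y : bool :=
  lifting s (origin n) x == lifting s (origin n) y.

Definition linked n (s : cube G n) x y : bool :=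
  lifting s (origin n) y == step (s y) (lifting s (origin n) x).

(** The number of vertices of the subtree spanned by the lift, the measure of the main induction. *)
Definition nclasses n (s : cube G n) : nat :=
  size (undup (codom (lifting s (origin n)))).

Section Good.
Variables (n : nat) (s : cube G n).
Hypothesis gs : good s.
Implicit Types (x y : {ffun 'I_n -> bool}).

Lemma sameE x0 x y : same s x y = (lifting s x0 x == lifting s x0 y).
Proof.
apply/eqP/eqP => e.
  by rewrite (lifting_change gs (origin n) x0 x) e -lifting_change.
by rewrite (lifting_change gs x0 _ x) e -lifting_change.
Qed.

Lemma linkedE x0 x y :
  linked s x y = (lifting s x0 y == step (s y) (lifting s x0 x)).
Proof.
have change x1 x2 : lifting s x1 y = step (s y) (lifting s x1 x) ->
    lifting s x2 y = step (s y) (lifting s x2 x).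
  move=> e; rewrite (lifting_change gs x1 x2 y) (lifting_change gs x1 x2 x) e.
  rewrite foldr_lifting //.
    exact: lifting_reduced.
  exact: ohead_lifting.
by apply/eqP/eqP => /change.
Qed.

Lemma same_refl x : same s x x.
Proof. exact: eqxx. Qed.

Lemma same_sym x y : same s x y = same s y x.
Proof. exact: eq_sym. Qed.

Lemma same_trans y x z : same s x y -> same s y z -> same s x z.
Proof. by move=> /eqP xy /eqP yz; rewrite /same xy yz. Qed.

Lemma same_label x y : same s x y -> s x = s y.
Proof.
by move=> /eqP xy; apply: Some_inj; rewrite -!(ohead_lifting gs (origin n)) xy.
Qed.

Lemma linked_flip i x : linked s x (flip i x).
Proof. by apply/eqP; rewrite lifting_flip. Qed.

Lemma linked_sym x y : linked s x y = linked s y x.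
Proof.
suff {x y} imp x y : linked s x y -> linked s y x by apply/idP/idP; apply: imp.
move=> /eqP xy; apply/eqP; rewrite xy step_back ?ohead_lifting //.
exact: lifting_reduced.
Qed.

Lemma linked_congr x x' y y' :
  same s x x' -> same s y y' -> linked s x y = linked s x' y'.
Proof.
by move=> xx' yy'; rewrite /linked (eqP xx') (eqP yy') (same_label yy').
Qed.

Lemma same_linked x y : same s x y -> linked s x y.
Proof.
move=> xy; rewrite (linked_congr (same_refl x) (y' := x)) 1?same_sym //.
by rewrite /linked step_id // ohead_lifting.
Qed.

Lemma linked_same x y : linked s x y -> s x = s y -> same s x y.
Proof.
by move=> /eqP xy exy; rewrite /same xy -exy step_id // ohead_lifting.
Qed.

Lemma linked_edge x y : linked s x y -> edge (s x) (s y) \/ s x = s y.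
Proof.
move=> /eqP; have := lifting_reduced gs (origin n) x.
have := lifting_reduced gs (origin n) y.
have := ohead_lifting gs (origin n) x; have := ohead_lifting gs (origin n) y.
set u := lifting _ _ y; set w := lifting _ _ x => hu hw ru rw e.
have w0 : w != [::] by apply/eqP => w0; rewrite w0 in hw.
case: (step_cases (s y) w0) => es.
- by right; move: hu; rewrite e es hw => -[].
- left; move: hw rw hu; rewrite es -e; case: (u) => //= b v [->] + [<-].
  by case/andP.
left; move: hu ru hw; rewrite e es; case: (w) => //= b v _ + [<-].
by case/andP; rewrite edge_sym.
Qed.

Lemma good_connected x0 (P : {ffun 'I_n -> bool} -> Prop) :
  P x0 -> (forall x y, linked s x y -> P x -> P y) -> forall x, P x.
Proof.
move=> P0 PS; apply: flip_ind P0 _ => x i; apply: PS; exact: linked_flip.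
Qed.

Section Compose.
Variables (m : nat) (t : cube G m).
Variable phi : {ffun 'I_m -> bool} -> {ffun 'I_n -> bool}.
Hypothesis tE : forall z, t z = s (phi z).
Hypothesis phi_linked : forall z i, linked s (phi z) (phi (flip i z)).

(** Faces, prisms and ends of prisms all have the form [s] composed with such a [phi]. Uniqueness of
    lifts then identifies the lift of [t] with that of [s] along [phi]. *)
Lemma rooted_lift_comp z0 : rooted_lift t z0 (lifting s (phi z0) \o phi).
Proof.
split=> [|z i] /=; rewrite tE; first by case: (liftingP (phi z0) gs).
by have := phi_linked z i; rewrite (linkedE (phi z0)) => /eqP.
Qed.

Lemma good_comp : good t.
Proof.
by move=> z0; exists (lifting s (phi z0) \o phi); apply: rooted_lift_comp.
Qed.

Lemma lifting_comp z0 z : lifting t z0 z = lifting s (phi z0) (phi z).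
Proof.
exact: rooted_lift_unique (liftingP z0 good_comp) (rooted_lift_comp z0) z.
Qed.

Lemma same_comp z z' : same t z z' = same s (phi z) (phi z').
Proof. by rewrite (sameE (phi (origin m))) /same !lifting_comp. Qed.

Lemma linked_comp z z' : linked t z z' = linked s (phi z) (phi z').
Proof. by rewrite (linkedE (phi (origin m))) /linked !lifting_comp tE. Qed.

Let change (u : seq G) :=
  foldr (@step G) (lifting s (phi (origin m)) (origin n)) u.

Let lifting_compE z :
  lifting t (origin m) z = change (lifting s (origin n) (phi z)).
Proof. by rewrite lifting_comp /change -lifting_change. Qed.

Lemma nclasses_comp : (nclasses t <= nclasses s)%N.
Proof.
rewrite /nclasses -[leqRHS](size_map change).
apply: uniq_leq_size (undup_uniq _) _ => u.
rewrite mem_undup => /codomP[z ->]; rewrite lifting_compE.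
by apply: map_f; rewrite mem_undup codom_f.
Qed.

Lemma nclasses_comp_lt y :
  (forall z, ~~ same s y (phi z)) -> (nclasses t < nclasses s)%N.
Proof.
move=> my; rewrite /nclasses.
have yin : lifting s (origin n) y \in undup (codom (lifting s (origin n))).
  by rewrite mem_undup codom_f.
rewrite -(ltn_predK (_ : 0 < size (undup (codom (lifting s _))))%N); last first.
  by rewrite lt0n size_eq0; apply: contraTneq yin => ->.
rewrite ltnS -(size_rem yin) -[leqRHS](size_map change).
apply: uniq_leq_size (undup_uniq _) _ => u.
rewrite mem_undup => /codomP[z ->]; rewrite lifting_compE; apply: map_f.
by rewrite mem_rem_uniq ?undup_uniq // inE mem_undup codom_f andbT eq_sym my.
Qed.

(** The classes reached by [t] contain the whole geodesic back to the root, because each flip stays,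
    retreats by one vertex or adds one. *)
Lemma lifting_drop z k : (k < size (lifting t (origin m) z))%N ->
  exists z', lifting t (origin m) z' = drop k (lifting t (origin m) z).
Proof.
move: z k; apply: (flip_ind (x0 := origin m)).
  case: (liftingP (origin m) good_comp) => t0 _; rewrite t0 => -[|//] _.
  by exists (origin m); rewrite t0.
move=> z i IH k; rewrite lifting_flip; last exact: good_comp.
set b := t _; set w := lifting t (origin m) z in IH *.
have w0 : w != [::].
  apply/eqP => w0; have := ohead_lifting good_comp (origin m) z.
  by rewrite -/w w0.
case: (step_cases b w0) => [->|e|e]; first exact: IH.
  by move: (step b w) e => v e ltk; have := IH k.+1; rewrite e /= ltnS; apply.
case: k => [_|k]; last by rewrite e /= ltnS; exact: IH.
by exists (flip i z); rewrite drop0 lifting_flip //; exact: good_comp.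
Qed.

End Compose.

(** At most one neighbouring class, so the vertex of a one-point tree counts too. By [linked_same],
    distinct labels tell a neighbour from the class itself. *)
Definition leaf x : bool :=
  [forall y, forall y',
     [&& linked s x y, s x != s y, linked s x y' & s x != s y']
     ==> same s y y'].

Lemma leafP x :
  reflect (forall y y', linked s x y -> s x <> s y -> linked s x y' ->
             s x <> s y' -> same s y y') (leaf x).
Proof.
apply: (iffP forallP) => lx y.
  move=> y' xy nxy xy' nxy'; have /forallP/(_ y')/implyP := lx y.
  by apply; apply/and4P; split=> //; apply/eqP.
by apply/forallP => y'; apply/implyP => /and4P[? /eqP ? ? /eqP ?]; exact: lx.
Qed.

Lemma leaf_congr x x' : same s x x' -> leaf x -> leaf x'.
Proof.
move=> xx' /leafP lx; apply/leafP => y y' xy nxy xy' nxy'.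
by apply: lx; rewrite ?(linked_congr xx' (same_refl _)) ?(same_label xx').
Qed.

(* A farthest missed class, seen from inside the connected set of the classes *)
(* that are hit, is a leaf.                                                   *)
Lemma missed_leaf m (t : cube G m) phi v :
  (forall z, t z = s (phi z)) ->
  (forall z i, linked s (phi z) (phi (flip i z))) ->
  (forall z, ~~ same s v (phi z)) ->
  exists2 l, leaf l & forall z, ~~ same s l (phi z).
Proof.
move=> tE phi_linked mv.
pose L := lifting s (phi (origin m)).
have phiL z : lifting t (origin m) z = L (phi z).
  exact: (lifting_comp tE phi_linked).
pose missed l := [forall z, ~~ same s l (phi z)].
have : missed v by exact/forallP.
case/(arg_maxnP (fun l => size (L l))) => l /forallP ml lmax; exists l => //.
suff nbr y : linked s l y -> s l <> s y -> L y = behead (L l).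
  apply/leafP => y y' ly nly ly' nly'; rewrite (sameE (phi (origin m))).
  by rewrite -/L (nbr y) // (nbr y').
rewrite (linkedE (phi (origin m))) -/L => /eqP ly nly.
have hl : ohead (L l) = Some (s l) := ohead_lifting gs _ _.
have l0 : L l != [::] by apply/eqP => l0; rewrite l0 in hl.
case: (step_cases (s y) l0) => e.
- by have := ohead_lifting gs (phi (origin m)) y; rewrite -/L ly e hl => -[].
- by rewrite ly [in RHS]e.
(* A missed neighbour farther out contradicts maximality; a hit one would, by [lifting_drop], have
   its parent [l] hit as well. *)
have: ~~ missed y.
  apply/negP => /lmax; rewrite ly e /=; rewrite /geq /= ltnn //.
case/forallPn => z; rewrite negbK (sameE (phi (origin m))) -/L => /eqP yz.
have [] := @lifting_drop m t phi tE phi_linked z 1.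
  by rewrite phiL -yz ly e /=; case: (L l) l0.
move=> z'; rewrite !phiL -yz ly e /= drop0 => lz'; have := ml z'.
by rewrite (sameE (phi (origin m))) -/L lz' eqxx.
Qed.

End Good.
End Lifts.

(** * Cubes of degree at most 1 *)

Section Degree.
Variable G : graph.

Lemma uniq_map_inj (T U : eqType) (f : T -> U) (l : seq T) :
  uniq (map f l) -> {in l &, injective f}.
Proof.
move=> ul x y xl yl fxy; rewrite -(nth_index x xl) -(nth_index x yl).
congr nth; apply/eqP; rewrite -(nth_uniq (f x) _ _ ul) ?size_map ?index_mem //.
by rewrite !(nth_map x) ?index_mem // !nth_index // fxy.
Qed.

Section Cube.
Variables (n : nat) (s : cube G n).
Implicit Types (x y z : {ffun 'I_n -> bool}) (i j : 'I_n).

Lemma degree_ge (A : {set 'I_n}) x :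
  (forall y z, (forall k, k \notin A -> y k = x k) ->
     (forall k, k \notin A -> z k = x k) -> s y = s z -> y = z) ->
  (#|A| <= degree s)%N.
Proof.
move=> injs; pose p : {ffun 'I_n -> option bool} :=
  [ffun k => if k \in A then None else Some (x k)].
have pE y : y \in face_vertices p -> forall k, k \notin A -> y k = x k.
  rewrite in_face_vertices => /forallP py k kA.
  by have := py k; rewrite ffunE (negbTE kA) /= => /eqP[].
have injp : injective_face s p.
  apply/'forall_implyP => y /pE yp; apply/'forall_implyP => z /pE zp.
  by apply/implyP => /eqP /(injs _ _ yp zp) ->.
apply: leq_trans (leq_bigmax_cond _ injp); apply: subset_leq_card.
by apply/subsetP => k kA; rewrite inE ffunE kA.
Qed.

Lemma degree0_flip i x : (degree s <= 0)%N -> s (flip i x) = s x.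
Proof.
move=> d0; apply/eqP; move: d0; apply: contraLR => nsx; rewrite -ltnNge.
have := @degree_ge [set i] x; rewrite cards1; apply.
have memE y : (forall k, k \notin [set i] -> y k = x k) ->
    y \in [:: x; flip i x].
  move=> yx; rewrite !inE; have [yi|yi] := eqVneq (y i) (x i).
    apply/orP; left; apply/eqP/ffunP => k; have := yx k; rewrite inE.
    by have [->|_ /(_ isT)] := eqVneq k i.
  apply/orP; right; apply/eqP/ffunP => k; have := yx k; rewrite inE ffunE.
  have [->|_ /(_ isT) ->] := eqVneq k i; rewrite ?addbF //.
  by move: yi; case: (y i); case: (x i).
move=> y z /memE yx /memE zx; apply: uniq_map_inj yx zx.
by rewrite /= inE eq_sym nsx.
Qed.

Lemma degree1_square i j x : i != j -> (degree s <= 1)%N ->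
  ~~ uniq [:: s x; s (flip i x); s (flip j (flip i x)); s (flip j x)].
Proof.
move=> ij; apply: contraL => us; rewrite -ltnNge.
have := @degree_ge [set i; j] x; rewrite cards2 ij; apply.
have memE y : (forall k, k \notin [set i; j] -> y k = x k) ->
    y \in [:: x; flip i x; flip j (flip i x); flip j x].
  move=> yx; rewrite !inE.
  have yE z : y i = z i -> y j = z j ->
      (forall k, k != i -> k != j -> z k = x k) -> y == z.
    move=> yi yj zk; apply/eqP/ffunP => k; have := yx k; rewrite !inE negb_or.
    have [->//|ki] := eqVneq k i; have [->//|kj /(_ isT) ->] := eqVneq k j.
    by rewrite zk.
  have ji : j != i by rewrite eq_sym.
  have [yi|yi] := eqVneq (y i) (x i); have [yj|yj] := eqVneq (y j) (x j).
  - by rewrite yE.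
  - suff -> : y == flip j x by rewrite !orbT.
    apply: yE => [||k ki kj].
    + by rewrite ffunE (negbTE ij) addbF.
    + rewrite ffunE eqxx.
      by move: yj; case: (y j); case: (x j).
    by rewrite ffunE (negbTE kj) addbF.
  - suff -> : y == flip i x by rewrite !orbT.
    apply: yE => [||k ki kj].
    + rewrite ffunE eqxx.
      by move: yi; case: (y i); case: (x i).
    + by rewrite ffunE (negbTE ji) addbF.
    by rewrite ffunE (negbTE ki) addbF.
  suff -> : y == flip j (flip i x) by rewrite !orbT.
  apply: yE => [||k ki kj].
  - rewrite !ffunE eqxx (negbTE ij) addbF.
    by move: yi; case: (y i); case: (x i).
  - rewrite !ffunE eqxx (negbTE ji) addbF.
    by move: yj; case: (y j); case: (x j).
  by rewrite !ffunE (negbTE ki) (negbTE kj) !addbF.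
by move=> y z /memE yx /memE zx; apply: uniq_map_inj yx zx.
Qed.

(** The lift follows the path from [x0] to [y] that sets the coordinates in increasing order:
    [mix k y] is its position after [k] moves and [L k y] the lift of these moves. Flat squares
    carry a flip past the later moves. *)
Lemma flat_good :
  (forall x i j, flat_square (s x) (s (flip i x)) (s (flip j (flip i x)))
     (s (flip j x))) -> good s.
Proof.
move=> flat x0.
pose mix k y : {ffun 'I_n -> bool} := 
    [ffun i : 'I_n => if (i < k)%N then y i else x0 i].
pose L k y := iteri k (fun l => step (s (mix l.+1 y))) [:: s x0].
have LS k y : L k.+1 y = step (s (mix k.+1 y)) (L k y) by [].
have mix0 y : mix 0 y = x0 by apply/ffunP => i; rewrite ffunE.
have mixn y : mix n y = y by apply/ffunP => i; rewrite ffunE ltn_ord.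
have mixS k y : mix k.+1 y = mix k y \/ exists i, mix k.+1 y = flip i (mix k y).
  case: (ltnP k n) => kn; last first.
    left; apply/ffunP => i; rewrite !ffunE ltnS.
    by have := leq_trans (ltn_ord i) kn => ik; rewrite ik ltnW.
  pose i := Ordinal kn.
  have mixk l : l != i -> mix k.+1 y l = mix k y l.
    move=> li; rewrite !ffunE ltnS leq_eqVlt.
    by rewrite (_ : (l == k :> nat) = false) //; apply/negbTE.
  have [yi|yi] := eqVneq (y i) (x0 i); [left|right; exists i];
    apply/ffunP => l; have [->|li] := eqVneq l i.
  - by rewrite !ffunE /= ltnn ltnS leqnn.
  - exact: mixk.
  - rewrite !ffunE eqxx /= ltnn ltnS leqnn.
    by move: yi; case: (y i); case: (x0 i).
  by rewrite mixk // [RHS]ffunE (negbTE li) addbF.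
have mix_flip k j y :
    mix k (flip j y) = if (j < k)%N then flip j (mix k y) else mix k y.
  apply/ffunP => i; case: ifP => jk; rewrite !ffunE;
    by have [->|_] := eqVneq i j; rewrite ?addbF ?jk.
have LP k y : [/\ reduced (L k y), ohead (L k y) = Some (s (mix k y)) &
    forall j, L k (flip j y) = step (s (mix k (flip j y))) (L k y)].
  elim: k y => [|k IH] y.
    by rewrite /L /= mix0; split=> // j; rewrite mix0 /= eqxx.
  have [rL hL fL] := IH y; split; rewrite ?LS ?ohead_step //.
    apply: reduced_step hL _ => //.
    case: (mixS k y) => [->|[i ->]]; first by right.
    exact: edge_label.
  (* Either [j] is already set (flat square), or it is being set now ([step_back]), or it is not yet
     reached (nothing changes). *)
  move=> j; rewrite !LS fL !mix_flip; have [jk|kj] := ltnP j k.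
    rewrite ltnW //; case: (mixS k y) => [->|[i ->]].
      by rewrite (step_id hL) (step_id (ohead_step _ _)).
    rewrite -(step_flat rL hL (flat (mix k y) i j)) //.
  rewrite (step_id hL) ltnS; case: leqP => jk; last first.
    by rewrite (step_id (ohead_step _ _)).
  have ejk : j = k :> nat by apply/eqP; rewrite eqn_leq jk.
  have fE : mix k.+1 y = mix k y \/ mix k.+1 y = flip j (mix k y).
    case: (mixS k y) => [->|[i ei]]; [by left|right].
    suff -> : j = i by [].
    apply: val_inj; rewrite /= ejk; apply/eqP.
    apply: contraT => ki; have := congr1 (fun f : {ffun _} => f i) ei.
    rewrite !ffunE eqxx ltnS leq_eqVlt eq_sym (negbTE ki) /=.
    by case: ifP => _; [case: (y i)|case: (x0 i)].
  by case: fE => ->; rewrite ?flipK (step_id hL) ?step_back.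
exists (L n); split=> [|x i].
  have Lx0 k : L k x0 = [:: s x0].
    elim: k => // k IH; rewrite LS IH step_id //; congr (Some (s _)).
    by apply/ffunP => i; rewrite ffunE if_same.
  exact: Lx0.
by have [_ _ ->] := LP n x; rewrite mixn.
Qed.

(** A closed walk of length 4 with two equal consecutive vertices is a closed walk of length 3,
    which without triangles has a further coincidence. *)
Lemma degree1_good : triangle_free G -> (degree s <= 1)%N -> good s.
Proof.
move=> tf ds; apply: flat_good => x i j.
have [<-|ij] := eqVneq i j; first by rewrite flipK; constructor 1.
have := degree1_square x ij ds.
have := edge_label s x i; have := edge_label s (flip i x) j.
have := edge_label s (flip j x) i; have := edge_label s x j.
rewrite flipC.
move: (s x) (s (flip i x)) (s (flip j (flip i x))) (s (flip j x)) => a b c d.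
move=> ad dc bc ab; rewrite /= !inE !negb_or !andbT.
have tri (u v w : G) : edge u v \/ u = v -> edge v w \/ v = w ->
    edge w u \/ w = u -> [\/ u = v, v = w | w = u].
  move=> [uv|->]; [|by constructor 1]; move=> [vw|->]; [|by constructor 2].
  by move=> [wu|->]; [case: tf; exists u, v, w|constructor 3].
have adjC (u v : G) : edge u v \/ u = v -> edge v u \/ v = u.
  by rewrite edge_sym => -[|->]; [left|right].
have [eab|_ /=] := eqVneq a b.
  rewrite -eab in bc *; case: (tri a c d bc (adjC _ _ dc) (adjC _ _ ad)).
  - by constructor 1.
  - by constructor 3.
  by constructor 2.
have [eac|_] := eqVneq a c; first by constructor 1.
have [ead|_ /=] := eqVneq a d.
  rewrite -ead in dc *; case: (tri a b c ab bc (adjC _ _ dc)).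
  - by constructor 2.
  - by constructor 4.
  by constructor 1.
have [ebc|_] := eqVneq b c.
  rewrite -ebc in dc *; case: (tri a b d ab (adjC _ _ dc) (adjC _ _ ad)).
  - by constructor 1.
  - by constructor 2.
  by constructor 4.
have [ebd|_ /=] := eqVneq b d; first by constructor 2.
have [ecd _|//] := eqVneq c d.
rewrite -ecd in ad *; case: (tri a b c ab bc (adjC _ _ ad)).
- by constructor 3.
- by constructor 2.
by constructor 1.
Qed.

(** Two free coordinates of an injective face would span an injective square, against [step_square].
    This keeps the bounding chains, built from good cubes, in degree at most 1. *)
Lemma good_degree1 : good s -> (degree s <= 1)%N.
Proof.
move=> gs; apply/bigmax_leqP => p /'forall_implyP injp.
rewrite leqNgt; apply/negP => /card_gt1P[i [j [/= pi pj ij]]].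
pose x : {ffun 'I_n -> bool} := [ffun k => odflt false (p k)].
have fx : x \in face_vertices p.
  apply/forallP => k; rewrite ffunE; case: (p k) => //= b; exact: eqxx.
have fflip k y : p k == None -> y \in face_vertices p ->
    flip k y \in face_vertices p.
  move=> pk; rewrite !in_face_vertices => /forallP py.
  apply/forallP => l; rewrite ffunE; have [->|_] := eqVneq l k.
    by rewrite pk.
  by rewrite addbF py.
rewrite !inE in pi pj.
have injs : {in face_vertices p &, injective s}.
  move=> y z yp zp /eqP yz; apply/eqP.
  by have /'forall_implyP/(_ z zp)/implyP := injp y yp; apply.
have := lifting_flip gs x i (flip j x).
rewrite flipC !(lifting_flip gs x) => /step_square.
move=> /(_ _ (lifting_reduced gs x x) (ohead_lifting gs x x)) /negP[].
rewrite (_ : uniq _ =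
  uniq (map s [:: x; flip i x; flip j (flip i x); flip j x])) //.
rewrite map_inj_in_uniq => [|y z yl zl]; last first.
  apply: injs; [move: yl|move: zl]; rewrite !inE => /or4P[]/eqP->;
    by rewrite ?fflip.
have neq k (y z : {ffun 'I_n -> bool}) : y k != z k -> y != z.
  by apply: contra => /eqP->.
have ji : j != i by rewrite eq_sym.
rewrite /= !inE !negb_or !andbT; apply/and3P; split;
  [apply/and3P; split; [apply: (neq i)|apply: (neq i)|apply: (neq j)]
  |apply/andP; split; [apply: (neq j)|apply: (neq i)]|apply: (neq i)];
  rewrite !ffunE eqxx ?(negbTE ij) ?(negbTE ji) ?addbF ?addbT;
  by case: (odflt _ _).
Qed.

End Cube.
End Degree.

(** * Pruning leaves *)

Section Retraction.
Variable G : graph.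

Section Cube.
Variables (n : nat) (s : cube G n).
Implicit Types (x y : {ffun 'I_n -> bool}).

Definition branch x y : bool := linked s x y && (s x != s y).

(** A predicate on labels rather than on cube vertices, so that a cube and a face reaching its whole
    tree yield the same choice. *)
Definition leaf_label (g : G) : bool := [exists x, leaf s x && (s x == g)].

(* Only the leaves carrying one canonical label are pruned, so that two      *)
(* adjacent leaves are never pruned together.                                *)
Definition pruned x : bool := leaf s x && (s x == choose leaf_label (s x)).

(** The neighbour is determined only up to [same]; the default [x] serves the one-point tree, where
    a leaf has no neighbour. *)
Definition retract x : {ffun 'I_n -> bool} :=
  if pruned x then odflt x [pick y | branch x y] else x.

Hypothesis gs : good s.

Lemma leaf_label_leaf x : leaf s x -> leaf_label (s x).
Proof. by move=> lx; apply/existsP; exists x; rewrite lx eqxx. Qed.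

Lemma pruned_label x x' : pruned x -> pruned x' -> s x = s x'.
Proof.
move=> /andP[lx /eqP->] /andP[lx' /eqP->].
by apply: choose_id; exact: leaf_label_leaf.
Qed.

Lemma pruned_leaf_label x y : pruned x -> leaf s y -> s x = s y -> pruned y.
Proof. by rewrite /pruned => /andP[_ +] -> /=; move=> + <-. Qed.

Lemma pruned_exists x : leaf s x -> exists y, pruned y.
Proof.
move=> lx; have /existsP[y /andP[ly ey]] := chooseP (leaf_label_leaf lx).
exists y; rewrite /pruned ly (eqP ey) /=; apply/eqP/choose_id.
  exact: leaf_label_leaf.
by rewrite -(eqP ey); exact: leaf_label_leaf.
Qed.

Lemma pruned_congr x x' : same s x x' -> pruned x -> pruned x'.
Proof.
move=> xx' px; apply: (pruned_leaf_label px); last exact: same_label xx'.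
by apply: leaf_congr xx' _ => //; case/andP: px.
Qed.

Lemma branch_congr x x' y y' :
  same s x x' -> same s y y' -> branch x y = branch x' y'.
Proof.
move=> xx' yy'; rewrite /branch (linked_congr gs xx' yy').
by rewrite (same_label gs xx') (same_label gs yy').
Qed.

Lemma branch_sym x y : branch x y = branch y x.
Proof. by rewrite /branch linked_sym // eq_sym. Qed.

Lemma leaf_branch x y y' : leaf s x -> branch x y -> branch x y' -> same s y y'.
Proof.
by move=> /leafP lx /andP[xy /eqP nxy] /andP[xy' /eqP nxy']; apply: lx.
Qed.

Variant retract_spec x : {ffun 'I_n -> bool} -> Prop :=
  | RetractId of ~~ pruned x : retract_spec x x
  | RetractIsolated of pruned x & (forall y, ~~ branch x y) : retract_spec x x
  | RetractLeaf y of pruned x & branch x y : retract_spec x y.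

Lemma retractP x : retract_spec x (retract x).
Proof.
rewrite /retract; case: (boolP (pruned x)) => px; last by constructor.
case: pickP => [y xy|nx] /=; first by constructor.
by constructor => // y; rewrite nx.
Qed.

Lemma retract_branch x y : pruned x -> branch x y -> same s (retract x) y.
Proof.
move=> px xy; case: retractP => [|_ /(_ y)|y' _ xy'].
- by rewrite px.
- by rewrite xy.
by apply: leaf_branch xy' xy; case/andP: px.
Qed.

Lemma retract_same x x' : same s x x' -> same s (retract x) (retract x').
Proof.
move=> xx'; case: (retractP x) => [npx|px nx|y px xy].
- case: retractP => [_ //|px' _|y px' _]; case/negP: npx;
    by apply: pruned_congr px'; rewrite same_sym.
- case: retractP => [//|//|y _].
  rewrite -(branch_congr xx' (same_refl _ _)) => xy.
  by have := nx y; rewrite xy.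
rewrite same_sym; apply: retract_branch (pruned_congr xx' px) _.
by rewrite -(branch_congr xx' (same_refl _ _)).
Qed.

Lemma retract_linked x : linked s x (retract x).
Proof.
case: retractP => [_|_ _|y _ /andP[]//]; apply: same_linked => //;
exact: same_refl.
Qed.

(** Adjacent classes have distinct labels while pruned ones share a label, so at most one of the two
    moves, and it moves onto the other, its only neighbour. *)
Lemma linked_retract x x' :
  linked s x x' -> linked s (retract x) (retract x').
Proof.
move=> xx'; have [exx'|nxx'] := eqVneq (s x) (s x').
  by apply/same_linked/retract_same/linked_same.
have bxx' : branch x x' by rewrite /branch xx'.
have bx'x : branch x' x by rewrite branch_sym.
have [px|npx] := boolP (pruned x); have [px'|npx'] := boolP (pruned x').
- by rewrite (pruned_label px px') eqxx in nxx'.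
- rewrite {2}/retract (negbTE npx'); apply/same_linked => //.
  exact: retract_branch.
- rewrite {1}/retract (negbTE npx); apply/same_linked => //.
  by rewrite same_sym; exact: retract_branch.
by rewrite /retract (negbTE npx) (negbTE npx').
Qed.

Lemma isolated_same x : (forall y, ~~ branch x y) -> forall y, same s x y.
Proof.
move=> nx; apply: (good_connected gs (x0 := x)); first exact: same_refl.
move=> y z yz xy; apply: (same_trans xy); apply: linked_same => //.
apply/eqP; apply: contraR (nx z) => nyz.
by rewrite (branch_congr xy (same_refl _ _)) /branch yz.
Qed.

(** Adjacent leaves have no other neighbours, so by connectedness they are the whole tree. *)
Lemma leaf_pair_same l x : leaf s l -> leaf s x -> branch x l ->
  forall y, same s x y \/ same s l y.
Proof.
move=> ll lx xl; apply: (good_connected gs (x0 := x)).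
  by left; exact: same_refl.
move=> y z yz; have [eyz|nyz] := eqVneq (s y) (s z).
  have yz' : same s y z by apply: linked_same.
  by move=> [xy|ly]; [left|right]; apply: same_trans yz'.
have bz : branch y z by rewrite /branch yz.
move=> [xy|ly]; [right|left].
  apply: leaf_branch lx xl _; by rewrite (branch_congr xy (same_refl _ _)).
apply: (leaf_branch ll); first by rewrite branch_sym.
by rewrite (branch_congr ly (same_refl _ _)).
Qed.

(** A class moved onto [l] would be pruned with a label other than that of [l], which is impossible;
    so only a one-point tree keeps [l]. *)
Lemma retract_missed l x : pruned l -> same s l (retract x) ->
  forall y, same s l y.
Proof.
move=> pl; case: retractP => [npx lx|px nx lx|y px xy ly].
- by rewrite (pruned_congr lx pl) in npx.
- by move=> y; apply: same_trans lx (isolated_same nx y).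
have /andP[_] := xy; rewrite (pruned_label px pl) (same_label gs ly) eqxx //.
Qed.

(** Apply [missed_leaf] to the 0-cube at [y]. *)
Lemma good_leaf x y : ~~ same s x y -> exists l, leaf s l.
Proof.
move=> nxy; have tm : `[< @graph_map (cube_graph 0) G [ffun=> s y] >].
  by apply/asboolP => z z' _; right; rewrite !ffunE.
have [||z|l ll _] := @missed_leaf G n s gs 0 (Cube tm) (fun=> y) x.
- by move=> z; rewrite ffunE.
- by move=> z [].
- exact: nxy.
by exists l.
Qed.

End Cube.

Section Surjective.
Variables (n m : nat) (s : cube G n) (t : cube G m).
Variable phi : {ffun 'I_m -> bool} -> {ffun 'I_n -> bool}.
Hypotheses (gs : good s) (tE : forall z, t z = s (phi z)).
Hypothesis phi_linked : forall z i, linked s (phi z) (phi (flip i z)).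
Hypothesis phi_onto : forall y, exists z, same s y (phi z).

Let gt : good t := good_comp gs tE phi_linked.
Let sameE := same_comp gs tE phi_linked.
Let linkedE := linked_comp gs tE phi_linked.

Lemma branch_comp z z' : branch t z z' = branch s (phi z) (phi z').
Proof. by rewrite /branch linkedE !tE. Qed.

Lemma leaf_comp z : leaf t z = leaf s (phi z).
Proof.
apply/leafP/leafP => lz y y' zy nzy zy' nzy'; last first.
  by rewrite sameE; apply: lz; rewrite -?linkedE -?tE.
have [u yu] := phi_onto y; have [u' yu'] := phi_onto y'.
have uu' : same t u u'.
  apply: lz; rewrite ?linkedE ?tE -?(same_label gs yu) -?(same_label gs yu') //.
    by rewrite -(linked_congr gs (same_refl _ _) yu).
  by rewrite -(linked_congr gs (same_refl _ _) yu').
apply: same_trans yu _; rewrite same_sym; apply: same_trans yu' _.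
by rewrite same_sym -sameE.
Qed.

Lemma leaf_label_comp : leaf_label t =1 leaf_label s.
Proof.
move=> g; apply/existsP/existsP => -[x /andP[lx /eqP<-]].
  by exists (phi x); rewrite -leaf_comp lx tE eqxx.
have [z xz] := phi_onto x; exists z.
by rewrite leaf_comp (leaf_congr gs xz) // tE (same_label gs xz) eqxx.
Qed.

Lemma pruned_comp z : pruned t z = pruned s (phi z).
Proof. by rewrite /pruned leaf_comp tE (eq_choose leaf_label_comp). Qed.

(** Naturality of pruning: leaves and their labels are the same for [t] and [s], and [choose]
    depends only on the extension of its predicate. *)
Lemma retract_comp z : same s (phi (retract t z)) (retract s (phi z)).
Proof.
case: retractP => [npz|pz nz|z' pz zz'].
- by rewrite /retract -pruned_comp (negbTE npz) same_refl.
- case: retractP => [_|_ _|y _ zy]; try exact: same_refl.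
  have [u yu] := phi_onto y; have := nz u; rewrite branch_comp.
  by rewrite -(branch_congr gs (same_refl _ _) yu) zy.
rewrite same_sym; apply: retract_branch => //; first by rewrite -pruned_comp.
by rewrite -branch_comp.
Qed.

End Surjective.

(** * The prism from a cube to its pruned version, with coordinate 0 as time *)

Section Prism.
Variable n : nat.
Implicit Types (z : {ffun 'I_n.+1 -> bool}).

Definition behead_vertex z : {ffun 'I_n -> bool} := [ffun j => z (lift ord0 j)].

Lemma behead_insert b x : behead_vertex (insert ord0 b x) = x.
Proof. by apply/ffunP => j; rewrite ffunE insert_lift. Qed.

Lemma behead_flip0 z : behead_vertex (flip ord0 z) = behead_vertex z.
Proof. by apply/ffunP => j; rewrite !ffunE addbF. Qed.

Lemma behead_flip j z :
  behead_vertex (flip (lift ord0 j) z) = flip j (behead_vertex z).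
Proof. by apply/ffunP => k; rewrite !ffunE (inj_eq lift_inj). Qed.

Variable s : cube G n.

Definition prism_map z : {ffun 'I_n -> bool} :=
  if z ord0 then retract s (behead_vertex z) else behead_vertex z.

Hypothesis gs : good s.

Lemma prism_map_linked z i : linked s (prism_map z) (prism_map (flip i z)).
Proof.
rewrite /prism_map; case: (unliftP ord0 i) => [j ->|->].
  rewrite behead_flip [flip _ _ _]ffunE (negbTE (neq_lift _ _)) addbF.
  by case: ifP => _; [apply: linked_retract => //|]; exact: linked_flip.
rewrite behead_flip0 [flip _ _ _]ffunE eqxx addbT; case: (z ord0) => /=.
  by rewrite linked_sym //; exact: retract_linked.
exact: retract_linked.
Qed.

Lemma prism_graph_map :
  `[< @graph_map (cube_graph n.+1) G [ffun z => s (prism_map z)] >].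
Proof.
apply/asboolP => z z' /cube_edgeP[i ->]; rewrite !ffunE.
exact/linked_edge/prism_map_linked.
Qed.

Definition prism : cube G n.+1 := Cube prism_graph_map.

Lemma prismE z : prism z = s (prism_map z).
Proof. by rewrite ffunE. Qed.

Lemma prism_good : good prism.
Proof. exact: (good_comp (phi := prism_map) gs prismE prism_map_linked). Qed.

Lemma prism_insert b x :
  prism (insert ord0 b x) = s (if b then retract s x else x).
Proof. by rewrite prismE /prism_map insert_at behead_insert. Qed.

End Prism.
End Retraction.

(** * The chain homotopy *)

Section Homotopy.
Variable G : graph.

Definition chain_good n (x : cubical_chains G n) : Prop :=
  exists2 s : cube G n, good s & x = << s >>.

(** Degenerate cubes belong to every level; by [nclasses_gt0], level 0 contains nothing else. *)
Definition chain_filtration k n (x : cubical_chains G n) : Prop :=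
  exists2 s : cube G n,
    degenerate s \/ good s /\ (nclasses s <= k)%N & x = << s >>.

Local Notation D := (generated (@D_generator G _)).
Local Notation F k := (generated (@chain_filtration k _)).

Lemma mem_F_degenerate k n (s : cube G n) : degenerate s -> << s >> \in F k.
Proof. by move=> ds; apply: mem_generated; exists s => //; left. Qed.

Lemma mem_F_good k n (s : cube G n) :
  good s -> (nclasses s <= k)%N -> << s >> \in F k.
Proof. by move=> gs sk; apply: mem_generated; exists s => //; right. Qed.

Lemma D_sub_F k n (x : cubical_chains G n) : x \in D -> x \in F k.
Proof.
by apply: generated_min => _ [s ds ->]; exact: mem_F_degenerate.
Qed.

Lemma nclasses_gt0 n (s : cube G n) : (0 < nclasses s)%N.
Proof.
rewrite /nclasses lt0n size_eq0; apply/eqP => e.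
have := codom_f (lifting s (origin n)) (origin n).
by rewrite -mem_undup e.
Qed.

Lemma nclasses_le_card n (s : cube G n) :
  (nclasses s <= #|{: {ffun 'I_n -> bool}}|)%N.
Proof. by rewrite (leq_trans (size_undup _)) // size_codom. Qed.

Section Faces.
Variables (n : nat) (s : cube G n.+1).
Hypothesis gs : good s.

Lemma insert_linked i b z j :
  linked s (insert i b z) (insert i b (flip j z)).
Proof. by rewrite insert_flip; exact: linked_flip. Qed.

Lemma good_face i b : good (face i b s).
Proof. exact: (good_comp gs (faceE i b s) (insert_linked i b)). Qed.

Lemma face_prism0 : face ord0 false (prism gs) = s.
Proof.
by apply/val_inj/ffunP => x; rewrite [LHS]faceE prism_insert.
Qed.

Lemma prism_map_insert_lift i b z :
  prism_map s (insert (lift ord0 i) b z) =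
  if z ord0 then retract s (insert i b (behead_vertex z))
  else insert i b (behead_vertex z).
Proof.
rewrite /prism_map.
have -> : behead_vertex (insert (lift ord0 i) b z) =
    insert i b (behead_vertex z).
  apply/ffunP => j; rewrite ffunE; case: (unliftP i j) => [k ->|->].
    have -> : lift ord0 (lift i k) = lift (lift ord0 i) (lift ord0 k).
      by apply: val_inj; rewrite /= /bump; lia.
    by rewrite !insert_lift ffunE.
  by rewrite !insert_at.
by rewrite insert_lift_ord0.
Qed.

Lemma face_prism_lift i b z : face (lift ord0 i) b (prism gs) z =
  s (if z ord0 then retract s (insert i b (behead_vertex z))
     else insert i b (behead_vertex z)).
Proof.
by rewrite faceE prismE prism_map_insert_lift.
Qed.

Lemma degenerate_prism : degenerate s -> degenerate (prism gs).
Proof.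
move=> /existsP[i /eqP di]; apply/existsP; exists (lift ord0 i).
apply/eqP/val_inj/ffunP => z.
have si x : same s (insert i false x) (insert i true x).
  apply: linked_same => //.
    by rewrite -(flip_insert i false); exact: linked_flip.
  by rewrite -!faceE di.
rewrite [LHS]face_prism_lift [RHS]face_prism_lift; apply: same_label => //.
by case: ifP => _ //; exact: retract_same.
Qed.

(** The far end misses every pruned class, unless the tree is a point, and then it is constant and
    so degenerate. *)
Lemma mem_F_face_prism1 k : (nclasses s <= k.+1)%N ->
  << face ord0 true (prism gs) >> \in F k.
Proof.
move=> sk; have tE z : face ord0 true (prism gs) z = s (retract s z).
  by rewrite faceE prism_insert.
have tl z i : linked s (retract s z) (retract s (flip i z)).
  by apply: linked_retract => //; exact: linked_flip.
have gt := good_comp gs tE tl.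
have [[x [y xy]]|allsame] := pselect (exists x y, ~~ same s x y).
  have [l ll] := good_leaf gs xy; have [p pp] := pruned_exists ll.
  apply: mem_F_good => //; rewrite -ltnS; apply: leq_trans sk.
  apply: (nclasses_comp_lt gs tE tl (y := p)) => z.
  apply: contra xy => /retract_missed.
  move=> /(_ gs pp) ap; apply: (same_trans (y := p)); rewrite ?ap //.
  by rewrite same_sym ap.
apply: mem_F_degenerate; apply/existsP; exists ord0.
apply/eqP/val_inj/ffunP => z; rewrite [LHS]faceE [RHS]faceE !tE.
apply: same_label => //; apply: contrapT => /negP ns.
by apply: allsame; do 2!eexists; exact: ns.
Qed.

Lemma face_prism_onto i b :
  (forall y, exists z, same s y (insert i b z)) ->
  face (lift ord0 i) b (prism gs) = prism (good_face i b).
Proof.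
move=> onto; apply/val_inj/ffunP => z.
rewrite [LHS]face_prism_lift [RHS]prismE [RHS]faceE /prism_map.
case: ifP => // _; apply: same_label => //; rewrite same_sym.
exact: (retract_comp gs (faceE i b s) (insert_linked i b) onto).
Qed.

End Faces.

Section MissingFaces.
Variables (n : nat) (s : cube G n.+2) (gs : good s) (i : 'I_n.+2) (b : bool).
Variable v : {ffun 'I_n.+2 -> bool}.
Hypothesis missed : forall z, ~~ same s v (insert i b z).

Lemma mem_F_prism_missing k : (nclasses s <= k.+1)%N ->
  << prism (good_face gs i b) >> \in F k.
Proof.
move=> sk; apply: mem_F_good; first exact: prism_good.
rewrite -ltnS; apply: leq_trans sk; apply: leq_ltn_trans.
  exact: (nclasses_comp (good_face gs i b) (prismE (good_face gs i b))
    (prism_map_linked (good_face gs i b))).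
exact: (nclasses_comp_lt gs (faceE i b s) (insert_linked gs i b) missed).
Qed.

(* The face misses a leaf; if the prism over it does not, then the tree of   *)
(* [s] is one edge and the face is constant, so its prism is degenerate.     *)
Lemma mem_F_missing_prism k : (nclasses s <= k.+1)%N ->
  << face (lift ord0 i) b (prism gs) >> \in F k.
Proof.
move=> sk; have [l ll ml] :=
  missed_leaf gs (faceE i b s) (insert_linked gs i b) missed.
pose psi (z : {ffun 'I_n.+2 -> bool}) :=
  let x := insert i b (behead_vertex z) in
  if z ord0 then retract s x else x.
have tE z : face (lift ord0 i) b (prism gs) z = s (psi z).
  exact: face_prism_lift.
have gt : good (face (lift ord0 i) b (prism gs)).
  exact/good_face/prism_good.
have tl z j : linked s (psi z) (psi (flip j z)).
  have := insert_linked (prism_good gs) (lift ord0 i) b z j.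
  rewrite (linked_comp gs (prismE gs) (prism_map_linked gs)).
  have psiE y : prism_map s (insert (lift ord0 i) b y) = psi y.
    exact: prism_map_insert_lift.
  by rewrite !psiE.
have [[z lz]|allmissed] := pselect (exists z, same s l (psi z)); last first.
  apply: mem_F_good => //; rewrite -ltnS; apply: leq_trans sk.
  apply: (nclasses_comp_lt gs tE tl (y := l)) => z.
  by apply: contra_notN allmissed => lz; exists z.
move: lz; rewrite /psi; case: ifP => [_|_]; last by rewrite (negbTE (ml _)).
set x := insert i b _; case: retractP => [_|_ _|y px xy] ly.
- by rewrite (negbTE (ml _)) in ly.
- by rewrite (negbTE (ml _)) in ly.
have xl : branch s x l by rewrite (branch_congr gs (same_refl _ _) ly).
have lx : leaf s x by case/andP: px.
have samex w : same s x (insert i b w).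
  have [//|] := leaf_pair_same gs ll lx xl (insert i b w).
  by rewrite (negbTE (ml _)).
(* Coordinate [ord0] is the time; the next one exists because the face of [s] has positive
   dimension. *)
apply: mem_F_degenerate; apply/existsP; exists (lift ord0 ord0).
have psi_same c w : same s (psi (insert (lift ord0 ord0) c w))
    (if w ord0 then retract s x else x).
  rewrite /psi insert_lift_ord0.
  rewrite same_sym; case: ifP => _ //; exact: retract_same.
apply/eqP/val_inj/ffunP => w; rewrite [LHS]faceE [RHS]faceE !tE.
apply: same_label => //; apply: (same_trans (psi_same _ _)).
by rewrite same_sym.
Qed.

End MissingFaces.

Definition prism_cube n (s : cube G n) : cubical_chains G n.+1 :=
  if pselect (good s) is left gs then << prism gs >> else 0.

Definition prism_chain n : cubical_chains G n -> cubical_chains G n.+1 :=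
  fglift (@prism_cube n : cube G n -> {freeg (cube G n.+1) / int}).

HB.instance Definition _ n :=
  GRing.isZmodMorphism.Build (cubical_chains G n) (cubical_chains G n.+1)
    (@prism_chain n) (@lift_is_additive _ _ _ (@prism_cube n)).

Lemma prism_chainU n (s : cube G n) : prism_chain << s >> = prism_cube s.
Proof. by rewrite /prism_chain liftU scale1r. Qed.

Lemma prism_cubeE n (s : cube G n) (gs : good s) :
  prism_cube s = << prism gs >>.
Proof.
rewrite /prism_cube; case: pselect => // gs'.
by congr << prism _ >>; exact: Prop_irrelevance.
Qed.

Lemma prism_chain_D n (x : cubical_chains G n.+1) :
  x \in D -> prism_chain x \in D.
Proof.
apply: (generated_min (S := preimage_group (@prism_chain n.+1) D)).
move=> _ [s ds ->]; rewrite mem_preimage_group /= prism_chainU.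
rewrite /prism_cube; case: pselect => [gs|_]; last exact: rpred0.
by apply: mem_generated; exists (prism gs) => //; exact: degenerate_prism.
Qed.

Lemma prism_chain_good n (x : cubical_chains G n) :
  prism_chain x \in generated (@chain_good n.+1).
Proof.
rewrite -(freeg_sumE (x : {freeg (cube G n) / int})) raddf_sum.
apply: rpred_sum => s _; rewrite -[coeff s x]intz -freegU_mulz raddfMz.
apply: rpredMz; rewrite /= prism_chainU /prism_cube.
case: pselect => [gs|_]; last exact: rpred0.
by apply: mem_generated; exists (prism gs) => //; exact: prism_good.
Qed.

(** The signs are all positive because the near end [s] of the prism enters its boundary with sign
    -1 and cancels [x]. *)
Definition homotopy n (x : cubical_chains G n.+1) : cubical_chains G n.+1 :=
  x + boundary (prism_chain x) + prism_chain (boundary x).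

Lemma homotopy_is_zmod_morphism n : zmod_morphism (@homotopy n).
Proof.
move=> x y; rewrite /homotopy !raddfB /= !opprD.
by rewrite [RHS]addrACA; congr (_ + _); rewrite [RHS]addrACA.
Qed.

HB.instance Definition _ n :=
  GRing.isZmodMorphism.Build (cubical_chains G n.+1) (cubical_chains G n.+1)
    (@homotopy n) (@homotopy_is_zmod_morphism n).

Lemma homotopy_good k n (s : cube G n.+2) (gs : good s) :
  (nclasses s <= k.+1)%N -> homotopy << s >> \in F k.
Proof.
move=> sk; rewrite /homotopy prism_chainU (prism_cubeE gs).
rewrite [boundary << prism gs >>]boundaryU [boundary << s >>]boundaryU.
rewrite /cube_boundary big_ord_recl face_prism0 raddf_sum expr1 scaleN1r opprB.
rewrite addrA [<< s >> + _]addrC subrK -addrA -big_split.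
apply: rpredD; first exact: mem_F_face_prism1.
apply: rpred_sum => i _.
rewrite (raddfZsign (@prism_chain _)) (raddfB (@prism_chain _)) /=.
have face_F b : << face (lift ord0 i) b (prism gs) >> -
    prism_chain << face i b s >> \in F k.
  rewrite prism_chainU (prism_cubeE (good_face gs i b)).
  have [onto|] := pselect (forall y, exists z, same s y (insert i b z)).
    by rewrite (face_prism_onto gs onto) subrr rpred0.
  move=> /existsNP[v /forallNP missed]; apply: rpredB.
    by apply: (mem_F_missing_prism gs (v := v)) => // z; apply/negP/missed.
  by apply: (mem_F_prism_missing gs (v := v)) => // z; apply/negP/missed.
(* The time coordinate shifts the others by one, so the sides get the sign opposite to that of the
   prisms over the faces. *)
have -> : (-1) ^+ (lift ord0 i).+1 = - (-1) ^+ i.+1 :> int.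
  by rewrite exprS mulN1r.
rewrite scaleNr -scalerN -scalerDr rpredZsign opprB.
have := rpredB (face_F true) (face_F false).
by rewrite opprB addrACA [- _ + _]addrC -addrACA.
Qed.

Lemma homotopy_F k n (x : cubical_chains G n.+2) :
  x \in F k.+1 -> homotopy x \in F k.
Proof.
apply: (generated_min (S := preimage_group (@homotopy n.+1) (F k))).
move=> _ [s [ds|[gs sk]] ->]; rewrite mem_preimage_group /=.
  have Ds : (<< s >> : cubical_chains G n.+2) \in D.
    by apply: mem_generated; exists s.
  apply: D_sub_F; rewrite /homotopy; apply: rpredD.
    by apply: rpredD => //; apply/boundary_D/prism_chain_D.
  exact/prism_chain_D/boundary_D.
exact: homotopy_good.
Qed.

Lemma cycle_bounds k n (x : cubical_chains G n.+2) :
  x \in F k -> boundary x \in D ->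
  exists2 y, y \in generated (@chain_good n.+3) & x - boundary y \in D.
Proof.
elim: k x => [|k IH] x xk dx.
  exists 0; rewrite ?rpred0 // raddf0 subr0; move: xk.
  apply: generated_min => _ [s [ds|[_ +]] ->].
    by apply: mem_generated; exists s.
  by rewrite leqNgt nclasses_gt0.
(* This chain is [x + boundary (prism_chain x)], with the same boundary as [x]; the subtracted term
   is degenerate because [boundary x] is. *)
have [||y yg yD] := IH (homotopy x - prism_chain (boundary x)).
- apply: rpredB; first exact: homotopy_F.
  exact/D_sub_F/prism_chain_D.
- by rewrite /homotopy addrK raddfD /= boundaryK addr0.
exists (y - prism_chain x); first by rewrite rpredB ?prism_chain_good.
by rewrite raddfB /= opprB addrA; move: yD; rewrite /homotopy addrK.
Qed.

End Homotopy.

(** * From good chains to the graded complex *)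

Section GradedHomology.
Variable G : graph.
Hypothesis tf : triangle_free G.

(** A cube of degree 0 is constant, hence degenerate in positive dimension. *)
Lemma C_generator_le0 k n (x : normalized_complex G n.+1) :
  k <= 0 -> x \in generated (@C_generator G k n.+1) -> x = 0.
Proof.
move=> k0 xk; apply/eqP; move: xk.
apply: (generated_min (S := zero_group (normalized_complex G n.+1))).
move=> y [s [nds sk _]]; case/negP: nds; apply/existsP; exists ord0.
apply/eqP/val_inj/ffunP => z; rewrite [LHS]faceE [RHS]faceE.
rewrite -(flip_insert ord0 false) degree0_flip //.
by rewrite -lez_nat; apply: Order.POrderTheory.le_trans k0.
Qed.

Local Notation proj := (\pi_(Quotient.quot (degenerate_subcomplex G _))).

Lemma C_le1_lift n (x : normalized_complex G n) : x \in C_le G 1 n ->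
  exists2 z : cubical_chains G n,
    z \in generated (@chain_good G n) & x = proj z.
Proof.
(* Membership in the image of an additive map can be checked on generators. *)
pose f := proj \o @sgval _ (generated (@chain_good G n)).
move=> xC; suff /asboolP[z <-] : x \in image_group f.
  by exists (sgval z) => //; exact: sgvalP.
move: xC; apply: generated_min => _ [s [_ ds ->]]; apply/asboolP.
have sg : << s >> \in generated (@chain_good G n).
  by apply: mem_generated; exists s => //; exact: degree1_good.
by exists (Subgroup sg).
Qed.

Lemma proj_good n (z : cubical_chains G n) :
  z \in generated (@chain_good G n) -> proj z \in C_le G 1 n.
Proof.
apply: (generated_min (S := preimage_group (proj : {additive _ -> _}) _)).
move=> _ [s gs ->]; rewrite mem_preimage_group -[_ << s >>]/(cube_class s).
have [ds|nds] := boolP (degenerate s).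
  by rewrite cube_class_degenerate ?rpred0.
by apply: mem_generated; exists s; split=> //; exact: good_degree1.
Qed.

Lemma proj_eq0 n (z : cubical_chains G n) :
  proj z = 0 -> z \in degenerate_subcomplex G n.
Proof.
by move=> z0; rewrite -[z]subr0 Quotient.idealrBE [X in _ == X]raddf0 z0.
Qed.

End GradedHomology.

Theorem theorem4p7 (G : graph) (hG : triangle_free G) (n : nat)
  (hn : (2 <= n)%N) (x : H_graded G 1 n) : x = 0.
Proof.
case: n hn x => [|[|n]] // _ x; rewrite -[x]reprK; move: (repr x) => c {x}.
rewrite -[RHS](raddf0 \pi_(homology (C_graded G 1) n.+2)).
apply/eqP; rewrite -Quotient.idealrBE subr0; apply/asboolP.
suff exact_at e : diff (C_graded G 1) n.+1 e = 0 ->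
    exists y, diff (C_graded G 1) n.+2 y = e.
  exact/exact_at/eqP/(sgvalP c).
rewrite -[e]reprK; move: (repr e) => u {c e}.
rewrite [LHS]quotient_map_pi => /eqP.
rewrite -[0 in X in X -> _](raddf0
  \pi_(Quotient.quot (within (C_le G 1) (C_le G (1 - 1)) n.+1))).
(* The boundary of [u] has positive dimension and lies in degree at most 0, so it is zero before
   passing to the quotient. *)
rewrite -Quotient.idealrBE subr0 => /C_generator_le0 du.
have [z zg uz] := C_le1_lift hG (sgvalP u).
have zD : boundary z \in degenerate_subcomplex G n.+1.
  apply: proj_eq0; rewrite -[RHS]du ?subrr //= uz.
  by rewrite [RHS]quotient_map_pi //; exact: boundary_D.
have [y yg yD] : exists2 y, y \in generated (@chain_good G n.+3) &
    z - boundary y \in degenerate_subcomplex G n.+2.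
  (* A cube has at most as many classes as vertices, which gives one bound for all terms of [z]. *)
  apply: (cycle_bounds (k := #|{: {ffun 'I_n.+2 -> bool}}|)) => //.
  move: zg; apply: generated_min => _ [s gs ->].
  exact: mem_F_good (nclasses_le_card s).
exists (\pi_(Quotient.quot (within (C_le G 1) (C_le G (1 - 1)) n.+3))
  (Subgroup (proj_good yg))).
rewrite [LHS]quotient_map_pi; congr \pi; apply: val_inj.
rewrite [RHS]uz; apply: etrans (quotient_map_pi (@boundary_D G n.+2) y) _.
by apply/eqP; rewrite eq_sym -Quotient.idealrBE.
Qed.
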